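(* For any field $\mathbb{F}$, $k\geq3$, $d \in \mathbb{Z}^k_{\geq1}$, and $r \in \mathbb{R}$, the sublevel set \[ \{T \in \mathbb{F}^{d_1} \otimes \cdots \otimes \mathbb{F}^{d_k} : \underset{\sim}{R}(T) \leq r\} \] is Zariski-closed.
   Context: For a $k$-tensor $T$, the tensor rank $R(T)$ is the smallest $r$ such that $T$ is a sum of $r$ simple tensors $v_1\otimes\cdots\otimes v_k$. The Kronecker product $S\boxtimes T$ of two $k$-tensors is the $k$-tensor obtained by taking the tensor product and grouping corresponding legs. The asymptotic tensor rank is $\underset{\sim}{R}(T) = \lim_{n\to\infty} R(T^{\boxtimes n})^{1/n}$. *)

(* Defs.v *)
From HB Require Import structures.
From mathcomp Require Import all_boot all_order all_algebra.
From mathcomp Require Import all_classical all_reals all_analysis.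
(* Not imported: its notations clash with those of the analysis library. *)
From mathcomp Require mpoly.

Set Implicit Arguments.
Unset Strict Implicit.
Unset Printing Implicit Defensive.

Import Order.TTheory GRing.Theory Num.Theory.
Import numFieldNormedType.Exports.

Local Open Scope classical_set_scope.
Local Open Scope ring_scope.

(* The tensor product of the coordinate spaces F^(J i), i < k, is identified
   with the space of arrays indexed by the product of the J i.  The legs are
   arbitrary finite types so that the legs of a Kronecker product can be the
   cartesian products of the legs of its factors. *)
Definition mindex (k : nat) (J : 'I_k -> finType) : finType :=
  {dffun forall i : 'I_k, J i}.

Definition tensor (F : fieldType) (k : nat) (J : 'I_k -> finType) :=
  {ffun mindex J -> F}.

(* v_1 (x) ... (x) v_k *)
Definition simple_tensor (F : fieldType) (k : nat) (J : 'I_k -> finType)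
    (v : forall i : 'I_k, {ffun J i -> F}) : tensor F J :=
  [ffun x : mindex J => \prod_(i < k) v i (x i)].

Definition sum_of_simple (F : fieldType) (k : nat) (J : 'I_k -> finType)
    (T : tensor F J) (r : nat) : Prop :=
  exists v : 'I_r -> forall i : 'I_k, {ffun J i -> F},
    T = \sum_(s < r) simple_tensor (v s).

(* Junk value 0 when no decomposition exists, which is only possible for
   k = 0, see tensor_rankP below. *)
Definition tensor_rank (F : fieldType) (k : nat) (J : 'I_k -> finType)
    (T : tensor F J) : nat :=
  xget 0%N [set r : nat | sum_of_simple T r /\
                          forall s, sum_of_simple T s -> (r <= s)%N].

Definition kron (F : fieldType) (k : nat) (J K : 'I_k -> finType)
    (S : tensor F J) (T : tensor F K) :
    tensor F (fun i => (J i * K i)%type : finType) :=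
  [ffun x : mindex (fun i => (J i * K i)%type : finType) =>
     S [ffun i : 'I_k => (x i).1] * T [ffun i : 'I_k => (x i).2]].

Fixpoint kron_legs (k : nat) (J : 'I_k -> finType) (n : nat) :
    'I_k -> finType :=
  if n is m.+1 then fun i => (kron_legs J m i * J i)%type : finType
  else fun _ => unit.

Fixpoint kron_pow (F : fieldType) (k : nat) (J : 'I_k -> finType)
    (T : tensor F J) (n : nat) : tensor F (kron_legs J n) :=
  if n is m.+1 then kron (kron_pow T m) T
  else [ffun=> 1].

(* The limit always exists when k > 0, by Fekete's lemma. *)
Definition asymptotic_rank (R : realType) (F : fieldType) (k : nat)
    (J : 'I_k -> finType) (T : tensor F J) : R :=
  lim ((((tensor_rank (kron_pow T n))%:R : R) `^ (n%:R^-1)) @[n --> \oo]).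

(* Zariski topology on the F-points of affine space with coordinates indexed
   by I: the closed sets are the common zero loci of families of polynomials
   over F.  The variables of {mpoly F[#|I|]} are matched with I through
   enum_val. *)
Definition zariski_closed (F : fieldType) (I : finType)
    (A : set {ffun I -> F}) : Prop :=
  exists P : set (mpoly.mpoly #|I| F),
    A = [set T | forall p, P p ->
                   mpoly.meval (fun j : 'I_#|I| => T (enum_val j)) p = 0].

Lemma tensor_rankP (F : fieldType) (k : nat) (J : 'I_k -> finType)
    (T : tensor F J) : (0 < k)%N ->
  sum_of_simple T (tensor_rank T) /\
  forall s, sum_of_simple T s -> (tensor_rank T <= s)%N.
Proof.
move=> k0; have [r Tr] : exists r, sum_of_simple T r.
  pose i0 := Ordinal k0.
  have [n [e [g [gK eK]]]] : exists n (e : 'I_n -> mindex J) (g : mindex J -> 'I_n),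
      cancel g e /\ cancel e g.
    exists #|mindex J|, enum_val, enum_rank.
    by split; [exact: enum_rankK | exact: enum_valK].
  exists n, (fun s i => [ffun a : J i =>
    (if i == i0 then T (e s) else 1) * (a == e s i)%:R]).
  apply/ffunP => x; rewrite sum_ffunE (bigD1 (g x)) //= ffunE.
  rewrite (bigD1 i0) //= !ffunE gK !eqxx mulr1 !big1 ?mulr1 ?addr0 //.
    move=> s nsx; rewrite ffunE.
    have [y ynx] : exists i, x i != e s i.
      apply/existsP; apply: contraR nsx; rewrite negb_exists => /forallP h.
      suff <- : e s = x by rewrite eK.
      by apply/ffunP => i; move/(_ i): h; rewrite negbK => /eqP.
    by rewrite (bigD1 y) //= ffunE (negbTE ynx) mulr0 mul0r.
  by move=> i /negbTE ni; rewrite ffunE ni eqxx mulr1.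
rewrite /tensor_rank; case: xgetP => [y -> //|none].
have exP : exists n, `[< sum_of_simple T n >] by exists r; apply/asboolP.
case: (ex_minnP exP) => m /asboolP Tm min; case: (none m); split=> // s Ts.
by apply: min; apply/asboolP.
Qed.

(* Main.v *)
(* Let A be a sublevel set and T a point of its Zariski closure.  A linear form
   evaluated at S^n is a polynomial in the entries of S, so T^n lies in the
   span of the S^n with S in A: T^n = c_1 S_1^n + ... + c_N S_N^n, where N is
   at most polynomial in n.  Fix n and expand the m-th Kronecker power of this
   identity: each of the N^m terms is a Kronecker product of powers of the
   fixed tensors S_1, ..., S_N of total order nm, so for b1 > r the rank of
   T^(nm) is at most K N^m b1^(nm) with K independent of m.  Hence the
   asymptotic rank of T is at most N^(1/n) b1; let n tend to infinity, then b1
   to r. *)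
Require Import Defs.
From mathcomp Require Import all_boot all_order all_algebra.
From mathcomp Require Import all_classical all_reals all_analysis.
From mathcomp Require Import zify ring lra.
From mathcomp Require mpoly.
Import (canonicals, coercions) mpoly.

Set Implicit Arguments.
Unset Strict Implicit.
Unset Printing Implicit Defensive.

Import Order.TTheory GRing.Theory Num.Theory.
Import numFieldNormedType.Exports.

Local Open Scope classical_set_scope.
Local Open Scope ring_scope.

(** * Exponential growth rates of submultiplicative sequences *)

(** The constant [C] makes the bound insensitive to a bounded factor; by [lim_root_leP], holding it
    for every [b] above [r] replaces the limit of n-th roots. *)
Definition growth (R : realType) (u : nat -> R) (b : R) : Prop :=
  exists C : R, forall m, u m <= C * b ^+ m.

Lemma growth_sub (R : realType) (u : nat -> R) (b C : R) n :
  (forall m, 0 <= u m) -> (forall m p, u (m + p)%N <= u m * u p) ->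
  0 < b -> (0 < n)%N -> (forall m, u (m * n)%N <= C * b ^+ (m * n)) ->
  growth u b.
Proof.
(* An index is a multiple of [n] plus a remainder; [M] dominates [u i / b ^+ i] for every remainder
   [i]. *)
move=> u0 uD b0 n0 uC; pose M := \sum_(i < n) u i / b ^+ i.
have C0 : 0 <= C by have := uC 0%N; rewrite mul0n mulr1; apply: le_trans.
exists (C * M) => m; rewrite {1 2}(divn_eq m n).
apply: (le_trans (uD _ _)); rewrite exprD mulrACA.
have mn := ltn_pmod m n0; apply: ler_pM => //.
rewrite -ler_pdivrMr ?exprn_gt0 // /M (bigD1 (Ordinal mn)) //= lerDl.
by apply: sumr_ge0 => i _; rewrite divr_ge0 ?exprn_ge0 ?(ltW b0).
Qed.

Lemma bernoulli_le (R : realType) (h : R) n :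
  0 <= h -> 1 + h *+ n <= (1 + h) ^+ n.
Proof.
move=> h0; elim: n => [|n IH]; first by rewrite mulr0n addr0.
rewrite exprS; apply: le_trans (ler_wpM2l _ IH); last by rewrite addr_ge0.
have -> : (1 + h) * (1 + h *+ n) = 1 + h *+ n.+1 + h * (h *+ n).
  by rewrite mulrS; ring.
by rewrite lerDl mulr_ge0 ?mulrn_wge0.
Qed.

Lemma expr_dominates_const (R : realType) (C b b' : R) : 0 < b -> b < b' ->
  exists M, forall m, (M <= m)%N -> C * b ^+ m <= b' ^+ m.
Proof.
move=> b0 bb'; pose h := b' / b - 1.
have h0 : 0 < h by rewrite subr_gt0 ltr_pdivlMr ?mul1r.
exists (Num.bound `|C / h|) => m Mm.
rewrite -ler_pdivlMr ?exprn_gt0 // -expr_div_n.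
have -> : b' / b = 1 + h by rewrite addrC subrK.
apply: le_trans (bernoulli_le m (ltW h0)).
have : C / h < m%:R.
  apply: (le_lt_trans (ler_norm _)).
  apply: (lt_le_trans (archi_boundP (normr_ge0 _))).
  by rewrite ler_nat.
rewrite ltr_pdivrMr // mulr_natl => /ltW /le_trans; apply.
by rewrite lerDr.
Qed.

(** Write [b' / b = 1 + h] and [n = l * D.+1]. Bernoulli applied to [(1 + h) ^+ l] bounds
    [(1 + h) ^+ n] below by a polynomial of degree [D.+1] in [l], while [n.+1 ^ D] has degree [D] in
    [l]. *)
Lemma expr_dominates_poly (R : realType) (D : nat) (b b' : R) :
  0 < b -> b < b' ->
  exists2 n, (0 < n)%N & (n.+1 ^ D)%:R * b ^+ n <= b' ^+ n.
Proof.
move=> b0 bb'; pose h := b' / b - 1.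
have h0 : 0 < h by rewrite subr_gt0 ltr_pdivlMr ?mul1r.
(* Since [n.+1 <= 2 * D.+1 * l], it is enough that [l] exceeds this ratio of the leading
   coefficients. *)
pose K : R := (2 * D.+1)%:R ^+ D / h ^+ D.+1.
pose l := (Num.bound `|K|).+1.
have Kl : K <= l%:R.
  apply: (le_trans (ler_norm _)); apply: ltW.
  apply: (lt_le_trans (archi_boundP (normr_ge0 _))).
  by rewrite ler_nat.
exists (l * D.+1)%N; first by rewrite muln_gt0.
rewrite -ler_pdivlMr ?exprn_gt0 // -expr_div_n.
have -> : b' / b = 1 + h by rewrite addrC subrK.
rewrite exprM; apply: (@le_trans _ _ ((h *+ l) ^+ D.+1)); last first.
  have h10 : 0 <= 1 + h by lra.
  apply: lerXn2r; rewrite ?nnegrE ?mulrn_wge0 ?exprn_ge0 ?(ltW h0) //.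
  by apply: le_trans (bernoulli_le l (ltW h0)); rewrite lerDr.
have -> : (h *+ l) ^+ D.+1 = l%:R ^+ D * (l%:R * h ^+ D.+1).
  by rewrite -mulr_natl exprMn exprSr mulrA.
apply: (@le_trans _ _ (l%:R ^+ D * (2 * D.+1)%:R ^+ D)); last first.
  by rewrite ler_wpM2l ?exprn_ge0 // -ler_pdivrMr ?exprn_gt0.
rewrite -!natrX -natrM ler_nat -expnMn.
case: (posnP D) => [->|D0]; first by rewrite !expn0.
by rewrite leq_exp2r //; nia.
Qed.

Lemma powR_invK (R : realType) (x : R) n :
  0 <= x -> (0 < n)%N -> (x `^ n%:R^-1) ^+ n = x.
Proof.
move=> x0 n0; rewrite -powR_mulrn ?powR_ge0 // -powRrM mulVf ?powRr1 //.
by rewrite pnatr_eq0 -lt0n.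
Qed.

Lemma growth_root (R : realType) (u : nat -> R) (b : R) n :
  (forall m, 0 <= u m) -> (forall m p, u (m + p)%N <= u m * u p) ->
  (0 < n)%N -> 0 < b -> u n `^ n%:R^-1 <= b -> growth u b.
Proof.
move=> u0 uD n0 b0 ub; apply: (@growth_sub _ u b (u 0%N) n) => //.
elim=> [|m IH]; first by rewrite mul0n mulr1.
rewrite mulSn exprD mulrCA; apply: (le_trans (uD _ _)).
apply: ler_pM => //; rewrite -(powR_invK (u0 n) n0).
by rewrite lerXn2r ?nnegrE ?powR_ge0 // ltW.
Qed.

Lemma near_root_le (R : realType) (u : nat -> R) (b b' : R) :
  (forall m, 0 <= u m) -> 0 < b -> b < b' -> growth u b ->
  \forall n \near \oo, u n `^ n%:R^-1 <= b'.
Proof.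
move=> u0 b0 bb' [C uC]; have [M CM] := expr_dominates_const C b0 bb'.
near=> n; have n0 : (0 < n)%N by near: n; exists 1%N.
have b'0 : 0 <= b' by rewrite ltW // (lt_trans b0).
rewrite -(@ler_pXn2r _ n) ?nnegrE ?powR_ge0 // powR_invK //.
apply: (le_trans (uC n)); apply: CM; near: n; exact: nbhs_infty_ge.
Unshelve. all: by end_near.
Qed.

(* Fekete's lemma in multiplicative form. *)
Lemma is_cvg_root (R : realType) (u : nat -> R) :
  (forall m, 0 <= u m) -> (forall m p, u (m + p)%N <= u m * u p) ->
  cvg ((u n `^ n%:R^-1) @[n --> \oo]).
Proof.
move=> u0 uD; pose a n := u n `^ n%:R^-1.
have a0 n : 0 <= a n by exact: powR_ge0.
(* The limit is the infimum of the roots. The index 0 is left out because [a 0] is 1 whatever [u]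
   is. *)
pose A := [set a n | n in [set n | (0 < n)%N]].
have hA : has_inf A.
  split; first by exists (a 1%N), 1%N.
  by exists 0 => _ [n _ <-].
apply/cvg_ex; exists (inf A); apply/cvgrPdist_le => e e0.
have i0 : 0 <= inf A.
  by apply: lb_le_inf; [exact: hA.1 | move=> _ [n _ <-]].
have [_ [n n0 <-] an] : exists2 x, A x & x < inf A + e / 2.
  by apply: inf_adherent => //; rewrite divr_gt0.
have g : growth u (inf A + e / 2).
  by apply: growth_root (ltW an) => //; lra.
have up : \forall n \near \oo, a n <= inf A + e.
  by apply: near_root_le g => //; lra.
near=> m; have m0 : (0 < m)%N by near: m; exists 1%N.
have l1 : inf A <= a m by apply: ge_inf; [exact: hA.2 | exists m].
have l2 : a m <= inf A + e by near: m.
by rewrite distrC ger0_norm -/(a m); lra.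
Unshelve. all: by end_near.
Qed.

Lemma lim_root_leP (R : realType) (u : nat -> R) (r : R) : 0 <= r ->
  (forall m, 0 <= u m) -> (forall m p, u (m + p)%N <= u m * u p) ->
  lim ((u n `^ n%:R^-1) @[n --> \oo]) <= r <->
  forall b, r < b -> growth u b.
Proof.
move=> r0 u0 uD; have ucvg := is_cvg_root u0 uD; split=> [ur b rb|gr].
  have : \forall n \near \oo, u n `^ n%:R^-1 <= b.
    by apply: cvgr_le ucvg _ _; apply: le_lt_trans rb.
  case=> N _ Nb; apply: (@growth_root _ u b N.+1) => //; first by lra.
  by apply: Nb => /=; exact: leqnSn.
apply/ler_addgt0Pr => e e0; apply: limr_le => //.
by apply: (@near_root_le _ u (r + e / 2)) => //; [lra|lra|apply: gr; lra].
Qed.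

(** * Linear spans and vanishing polynomials *)

(** A maximal free family of points of [A] spans every point of [A]. The columns of its cokernel are
    then linear forms vanishing on [A], hence at [t], so [t] lies in the span too. *)
Lemma span_of_annihilator (F : fieldType) (p : nat) (A : set 'rV[F]_p)
    (t : 'rV[F]_p) :
  (forall c : 'cV[F]_p, (forall s, A s -> s *m c = 0) -> t *m c = 0) ->
  exists q, [/\ (q <= p)%N & exists (B : 'M[F]_(q, p)) (c : 'rV[F]_q),
    (forall i, A (row i B)) /\ t = c *m B].
Proof.
move=> tA.
pose P q := `[< exists B : 'M[F]_(q, p), row_free B /\ forall i, A (row i B) >].
have P0 : exists q, P q.
  exists 0%N; apply/asboolP; exists 0; split; last by case.
  by rewrite /row_free mxrank0.
have Pp q : P q -> (q <= p)%N.
  by move=> /asboolP [B [/eqP Bf _]]; have := rank_leq_col B; rewrite Bf.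
case: (ex_maxnP P0 Pp) => q /asboolP [B [Bf BA]] qmax.
exists q; split; first exact: Pp (asboolT (ex_intro _ B (conj Bf BA))).
have AB s : A s -> (s <= B)%MS.
  move=> As; apply: contraT => sB; suff /qmax : P (1 + q)%N by rewrite ltnn.
  apply/asboolP; exists (col_mx s B); split; last first.
    move=> i; rewrite -(fintype.splitK i); case: (fintype.split i) => j /=.
      by rewrite rowKu row_id.
    by rewrite rowKd.
  rewrite -row_leq_rank -addsmxE mxrank_disjoint_sum.
    rewrite (eqP Bf) leq_add2r lt0n mxrank_eq0.
    by apply: contra sB => /eqP ->; rewrite sub0mx.
  apply/eqP; rewrite -mxrank_eq0.
  apply: contraR sB; rewrite -lt0n => c0.
  apply: submx_trans (capmxSr s B).
  rewrite -(geq_leqif (mxrank_leqif_sup (capmxSl s B))).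
  by apply: leq_trans c0; exact: rank_leq_row.
have /submxP [c ->] : (t <= B)%MS; last by exists B, c.
rewrite submxE; apply/eqP/matrixP => i j; rewrite mxE.
have /tA : forall s, A s -> s *m col j (cokermx B) = 0.
  move=> s /AB; rewrite submxE => /eqP sB; rewrite colE mulmxA sB mul0mx //.
by move=> /matrixP /(_ i 0); rewrite colE mulmxA -colE !mxE => ->.
Qed.

(* A linear form in the monomials with exponents at most n is a polynomial, so
   if it vanishes on A it vanishes at every T in the Zariski closure of A; and
   a product of n entries of T is one of these monomials.  The bound on N,
   polynomial in n, is what makes the number of terms asymptotically
   negligible. *)
Lemma power_in_span (F : fieldType) (I : finType) (A : set {ffun I -> F})
    (T : {ffun I -> F}) n :
  (forall p : mpoly.mpoly #|I| F,
     (forall S, A S ->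
        mpoly.meval (fun j : 'I_#|I| => S (enum_val j)) p = 0) ->
     mpoly.meval (fun j : 'I_#|I| => T (enum_val j)) p = 0) ->
  exists N, [/\ (N <= n.+1 ^ #|I|)%N &
    exists (c : 'I_N -> F) (S : 'I_N -> {ffun I -> F}),
      (forall a, A (S a)) /\
      forall x : 'I_n -> I,
        \prod_(j < n) T (x j) = \sum_a c a * \prod_(j < n) S a (x j)].
Proof.
move=> TA; pose E := {ffun I -> 'I_n.+1}.
pose mon (S : {ffun I -> F}) : 'rV[F]_#|{: E}| :=
  \row_e \prod_y S y ^+ ((enum_val e : E) y).
have [|N [Np [B [c [BA tE]]]]] := @span_of_annihilator F _ (mon @` A) (mon T).
  move=> l lA; pose p : mpoly.mpoly #|I| F := \sum_(e < #|{: E}|)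
    mpoly.mpolyC #|I| (l e 0) *
    \prod_(j < #|I|)
      mpoly.mpolyX F (mpoly.mnm1 j) ^+ ((enum_val e : E) (enum_val j)).
  have pE (S : {ffun I -> F}) :
      mpoly.meval (fun j : 'I_#|I| => S (enum_val j)) p = (mon S *m l) 0 0.
    rewrite mxE /p rmorph_sum; apply: eq_bigr => e _.
    rewrite rmorphM /= mpoly.mevalC mulrC mxE rmorph_prod; congr (_ * _).
    rewrite [RHS](reindex _ (onW_bij _ (enum_val_bij I))) /=.
    by apply: eq_bigr => j _; rewrite rmorphXn /= mpoly.mevalXU.
  apply/matrixP => i j; rewrite !ord1 -pE mxE; apply: TA => S AS.
  by rewrite pE lA ?mxE //; exists S.
exists N; split; first by rewrite (leq_trans Np) // card_ffun card_ord.
have BA' a : exists S, A S /\ mon S = row a B.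
  by have [S AS SB] := BA a; exists S.
have [S SE] := choice BA'.
exists (fun a => c 0 a), S; split=> [a|x]; first by have [] := SE a.
(* The exponent of the variable [y] is its multiplicity among the [x j]; it is at most [n], so
   [inord] does not take its default value. *)
pose ex (y : I) : 'I_n.+1 := inord #|[pred j | x j == y]|.
have exE (U : {ffun I -> F}) :
    \prod_(j < n) U (x j) = mon U 0 (enum_rank [ffun y => ex y]).
  rewrite mxE enum_rankK (partition_big x xpredT) //=; apply: eq_bigr => y _.
  rewrite ffunE inordK; last by rewrite ltnS (leq_trans (max_card _)) ?card_ord.
  by rewrite -prodr_const; apply: eq_bigr => j /eqP ->.
rewrite exE tE mxE; apply: eq_bigr => a _.
by have [_ SB] := SE a; rewrite exE SB mxE.
Qed.

(** * Ranks of Kronecker powers *)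

(* A tensor power of order n is viewed as a function on infinite sequences of
   multi-indices that depends on the first n positions only.  All powers then
   have the same legs nat -> J i, and regrouping or permuting the factors of a
   Kronecker product is reindexing nat. *)
Definition mseq (k : nat) (J : 'I_k -> finType) := forall i : 'I_k, nat -> J i.

Definition at_pos (k : nat) (J : 'I_k -> finType) (w : mseq J) (j : nat) :
  mindex J := [ffun i : 'I_k => w i j].

Definition rank_le (F : fieldType) (k : nat) (J : 'I_k -> finType)
    (f : mseq J -> F) (q : nat) : Prop :=
  exists v : 'I_q -> forall i : 'I_k, (nat -> J i) -> F,
    forall w, f w = \sum_(s < q) \prod_(i < k) v s i (w i).

Definition krank (F : fieldType) (k : nat) (J : 'I_k -> finType)
  (T : tensor F J) (n : nat) : nat := tensor_rank (kron_pow T n).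

Fixpoint nest (k : nat) (J : 'I_k -> finType) (i : 'I_k) (a : nat -> J i)
    (n : nat) : kron_legs J n i :=
  if n is m.+1 then (nest a m, a m) else tt.

Fixpoint unnest (k : nat) (J : 'I_k -> finType) (i : 'I_k) (x0 : J i)
    (n : nat) : kron_legs J n i -> nat -> J i :=
  if n is m.+1 then
    fun p j => if j == m then p.2 else @unnest k J i x0 m p.1 j
  else fun _ _ => x0.

Lemma eq_nest k (J : 'I_k -> finType) (i : 'I_k) (a b : nat -> J i) n :
  (forall j, (j < n)%N -> a j = b j) -> nest a n = nest b n.
Proof.
elim: n => [//|n IH] ab /=; rewrite IH ?ab // => j jn; apply: ab.
exact: ltn_trans jn _.
Qed.

Lemma unnestK k (J : 'I_k -> finType) (i : 'I_k) (x0 : J i) n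
  (p : kron_legs J n i) : nest (unnest x0 p) n = p.
Proof.
elim: n p => [[]//|n IH] [p a].
have unnestS j : @unnest k J i x0 n.+1 (p, a) j =
    if j == n then a else unnest x0 p j by [].
have unnest_last : @unnest k J i x0 n.+1 (p, a) n = a.
  by rewrite unnestS; case: eqP.
rewrite -[LHS]/(nest (@unnest k J i x0 n.+1 (p, a)) n,
  @unnest k J i x0 n.+1 (p, a) n); congr pair => //.
rewrite -[RHS]IH; apply: eq_nest => j jn.
by rewrite unnestS; case: eqP jn => // ->; rewrite ltnn.
Qed.

Lemma kron_pow_nest (F : fieldType) k (J : 'I_k -> finType) (T : tensor F J)
    n (w : mseq J) :
  kron_pow T n [ffun i => nest (w i) n] = \prod_(j < n) T (at_pos w j).
Proof.
elim: n => [|n IH]; first by rewrite ffunE big_ord0.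
rewrite big_ord_recr /= -IH ffunE; congr (_ * _); congr (_ _).
  by apply/ffunP => i; rewrite !ffunE.
by apply/ffunP => i; rewrite !ffunE.
Qed.

Lemma rank_le_krank (F : fieldType) k (J : 'I_k -> finType) (T : tensor F J)
    n : (0 < k)%N ->
  rank_le (fun w => \prod_(j < n) T (at_pos w j)) (krank T n).
Proof.
move=> k0; have [[v vE] _] := tensor_rankP (kron_pow T n) k0.
exists (fun s i a => v s i (nest a n)) => w.
rewrite -kron_pow_nest vE sum_ffunE; apply: eq_bigr => s _.
by rewrite ffunE; apply: eq_bigr => i _; rewrite ffunE.
Qed.

(** The factors of a decomposition over sequences may depend on positions beyond [n]. Evaluating
    them at finite multi-indices padded with [x0] gives a decomposition of [kron_pow T n]. *)
Lemma krank_le (F : fieldType) k (J : 'I_k -> finType) (T : tensor F J)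
    n q : (0 < k)%N -> (forall i, J i) ->
  rank_le (fun w => \prod_(j < n) T (at_pos w j)) q -> (krank T n <= q)%N.
Proof.
move=> k0 x0 [v vE]; have [_] := tensor_rankP (kron_pow T n) k0; apply.
exists (fun s i => [ffun p => v s i (unnest (x0 i) p)]).
apply/ffunP => z; rewrite sum_ffunE.
have -> : z = [ffun i => nest (unnest (x0 i) (z i)) n].
  by apply/ffunP => i; rewrite ffunE unnestK.
rewrite (kron_pow_nest T n (fun i => unnest (x0 i) (z i))) vE.
apply: eq_bigr => s _; rewrite ffunE; apply: eq_bigr => i _.
by rewrite !ffunE unnestK.
Qed.

Lemma eq_rank_le (F : fieldType) k (J : 'I_k -> finType) (f g : mseq J -> F)
    q : rank_le f q -> g =1 f -> rank_le g q.
Proof. by move=> [v vE] gf; exists v => w; rewrite gf. Qed.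

Lemma rank_le_fin (F : fieldType) k (J : 'I_k -> finType) (I : finType)
    (v : I -> forall i : 'I_k, (nat -> J i) -> F) :
  rank_le (fun w => \sum_s \prod_(i < k) v s i (w i)) #|I|.
Proof.
exists (fun s => v (enum_val s)) => w.
by rewrite (reindex _ (onW_bij _ (enum_val_bij I))).
Qed.

Lemma rank_le0 (F : fieldType) k (J : 'I_k -> finType) :
  rank_le (fun _ : mseq J => 0 : F) 0.
Proof. by exists (fun _ _ _ => 0) => w; rewrite big_ord0. Qed.

Lemma rank_leC (F : fieldType) k (J : 'I_k -> finType) (c : F) :
  (0 < k)%N -> rank_le (fun _ : mseq J => c) 1.
Proof.
move=> k0; exists (fun _ i _ => if i == Ordinal k0 then c else 1) => w.
rewrite big_ord1 (bigD1 (Ordinal k0)) //= ?eqxx big1 ?mulr1 //.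
by move=> i /negbTE ->.
Qed.

Lemma rank_leD (F : fieldType) k (J : 'I_k -> finType) (f g : mseq J -> F)
    a b : rank_le f a -> rank_le g b -> rank_le (fun w => f w + g w) (a + b).
Proof.
move=> [u uE] [v vE].
have := rank_le_fin (fun s : 'I_a + 'I_b =>
  match s with inl s => u s | inr s => v s end).
rewrite card_sum !card_ord => /eq_rank_le; apply => w.
by rewrite big_sumType /= uE vE.
Qed.

Lemma rank_leM (F : fieldType) k (J : 'I_k -> finType) (f g : mseq J -> F)
    a b : rank_le f a -> rank_le g b -> rank_le (fun w => f w * g w) (a * b).
Proof.
move=> [u uE] [v vE].
have := rank_le_fin (fun (s : 'I_a * 'I_b) i x => u s.1 i x * v s.2 i x).
rewrite card_prod !card_ord => /eq_rank_le; apply => w.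
rewrite uE vE big_distrlr pair_bigA /=.
by apply: eq_bigr => s _; rewrite big_split.
Qed.

Lemma rank_le_sum (F : fieldType) k (J : 'I_k -> finType) (I : finType)
    (f : I -> mseq J -> F) (q : I -> nat) :
  (forall i, rank_le (f i) (q i)) ->
  rank_le (fun w => \sum_i f i w) (\sum_i q i).
Proof.
move=> fq; elim: (index_enum I) => [|i s IH].
  rewrite big_nil; have := rank_le0 F J.
  by move=> /eq_rank_le; apply => w; rewrite big_nil.
rewrite big_cons; have := rank_leD (fq i) IH.
by move=> /eq_rank_le; apply => w; rewrite big_cons.
Qed.

Lemma rank_le_prod (F : fieldType) k (J : 'I_k -> finType) (I : finType)
    (f : I -> mseq J -> F) (q : I -> nat) : (0 < k)%N ->
  (forall i, rank_le (f i) (q i)) ->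
  rank_le (fun w => \prod_i f i w) (\prod_i q i).
Proof.
move=> k0 fq; elim: (index_enum I) => [|i s IH].
  rewrite big_nil; have := rank_leC J (1 : F) k0.
  by move=> /eq_rank_le; apply => w; rewrite big_nil.
rewrite big_cons; have := rank_leM (fq i) IH.
by move=> /eq_rank_le; apply => w; rewrite big_cons.
Qed.

(** Reindexing positions by [nth 0 l] acts on each leg separately, so it turns products of leg
    functions into products of leg functions. *)
Lemma rank_le_seq (F : fieldType) k (J : 'I_k -> finType) (T : tensor F J)
    (l : seq nat) : (0 < k)%N ->
  rank_le (fun w => \prod_(j <- l) T (at_pos w j)) (krank T (size l)).
Proof.
move=> /(rank_le_krank T (size l)) [v vE].
exists (fun s i a => v s i (fun j => a (nth 0%N l j))) => w.
rewrite -(vE (fun i j => w i (nth 0%N l j))) (big_nth 0%N) big_mkord.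
by apply: eq_bigr => j _; congr (T _); apply/ffunP => i; rewrite !ffunE.
Qed.

Lemma krankD (F : fieldType) k (J : 'I_k -> finType) (T : tensor F J) m n :
  (0 < k)%N -> (forall i, J i) ->
  (krank T (m + n) <= krank T m * krank T n)%N.
Proof.
move=> k0 x0; apply: krank_le => //.
have := rank_leM (rank_le_seq T (iota 0 m) k0) (rank_le_seq T (iota m n) k0).
rewrite !size_iota => /eq_rank_le; apply => w.
rewrite -big_cat -iotaD -(big_mkord xpredT (fun j => T (at_pos w j))).
by rewrite /index_iota subn0.
Qed.

(* Multiplying out the m-th power of a sum of N tensor powers and grouping
   equal factors: a monomial contains only powers of S_1, ..., S_N, whatever
   the order in which they occur. *)
Lemma krank_mix (R : realType) (F : fieldType) k (J : 'I_k -> finType)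
    (T : tensor F J) n N (c : 'I_N -> F) (S : 'I_N -> tensor F J)
    (C : 'I_N -> R) (b : R) :
  (0 < k)%N -> (forall i, J i) ->
  (forall w : mseq J, \prod_(j < n) T (at_pos w j) =
     \sum_a c a * \prod_(j < n) S a (at_pos w j)) ->
  (forall a m, (krank (S a) m)%:R <= C a * b ^+ m) ->
  forall m, (krank T (m * n))%:R <= (\prod_a C a) * (N%:R * b ^+ n) ^+ m.
Proof.
move=> k0 x0 TE SC m.
(* The [m * n] positions form [m] blocks of length [n]. A function [g] chooses one of the [N] terms
   in each block, and [l g a] lists the positions where [a] is chosen. *)
pose l (g : {ffun 'I_m -> 'I_N}) a :=
  flatten [seq iota (val p * n) n | p <- enum [pred p | g p == a]].
have lE (A : comPzSemiRingType) g a (f : nat -> A) :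
    \prod_(j <- l g a) f j =
    \prod_(p < m | g p == a) \prod_(j <- iota (p * n) n) f j.
  by rewrite /l big_flatten big_map big_enum.
have rk : rank_le (fun w => \prod_(j < m * n) T (at_pos w j))
    (\sum_(g : {ffun 'I_m -> 'I_N}) 1 * \prod_a krank (S a) (size (l g a)))%N.
  have := rank_le_sum (fun g : {ffun 'I_m -> 'I_N} =>
    rank_leM (rank_leC J (\prod_p c (g p)) k0)
      (rank_le_prod k0 (fun a => rank_le_seq (S a) (l g a) k0))).
  move=> /eq_rank_le; apply => w.
  rewrite -(big_mkord xpredT (fun j => T (at_pos w j))) big_nat_mul big_mkord.
  transitivity (\prod_(p < m) \sum_a
      c a * \prod_(j <- iota (p * n) n) S a (at_pos w j)).
    apply: eq_bigr => p _; rewrite mulSn addnC.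
    (* The identity for [T] holds at all sequences, so block [p] is handled by shifting [w]. *)
    have /(_ (fun i j => w i (p * n + j)%N)) := TE.
    have sh (U : tensor F J) :
        \prod_(j < n) U (at_pos (fun i j => w i (p * n + j)%N) j) =
        \prod_(j <- iota (p * n) n) U (at_pos w j).
      rewrite -[in RHS](addn0 (p * n)%N) iotaDl big_map.
      rewrite -[X in iota 0 X]subn0 big_mkord.
      by apply: eq_bigr => j _; congr (U _); apply/ffunP => i; rewrite !ffunE.
    rewrite sh /index_iota addKn => ->.
    by apply: eq_bigr => a _; rewrite sh.
  rewrite bigA_distr_bigA; apply: eq_bigr => g _; rewrite big_split /=.
  congr (_ * _); rewrite (partition_big g xpredT) //=.
  apply: eq_bigr => a _; rewrite lE; apply: eq_bigr => p /eqP -> //.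
have := krank_le k0 x0 rk.
rewrite -(ler_nat R) => /le_trans; apply.
(* The factor [N ^ m] counts the functions [g], which reduces the bound to one for each [g]. *)
rewrite natr_sum exprMn -natrX -[X in (X ^ m)%N]card_ord.
rewrite -[in X in (_ ^ X)%N](card_ord m) -card_ffun.
rewrite mulrCA mulr_natl -sumr_const; apply: ler_sum => g _.
rewrite mul1n natr_prod.
(* For fixed [g] the lists [l g a] partition the positions, so their sizes add up to [m * n]. *)
have -> : (b ^+ n) ^+ m = \prod_a b ^+ size (l g a).
  have bl (s : seq nat) : b ^+ size s = \prod_(j <- s) b.
    by rewrite big_const_seq count_predT -Monoid.iteropE.
  under [RHS]eq_bigr => a _ do rewrite bl lE.
  transitivity (\prod_(p < m) \prod_(j <- iota (p * n) n) b).
    rewrite -[in LHS](card_ord m) -prodr_const.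
    by apply: eq_bigr => p _; rewrite -bl size_iota.
  by rewrite (partition_big g xpredT).
rewrite -big_split; apply: ler_prod => a _; rewrite ler0n /=; exact: SC.
Qed.

(** * Sublevel sets of the asymptotic rank *)

Lemma asymptotic_rank_leP (R : realType) (F : fieldType) k
    (J : 'I_k -> finType) (T : tensor F J) (r : R) :
  (0 < k)%N -> (forall i, J i) -> 0 <= r ->
  asymptotic_rank R T <= r <->
  forall b, r < b -> growth (fun n => (krank T n)%:R) b.
Proof.
move=> k0 x0 r0; apply: lim_root_leP => // m p.
by rewrite -natrM ler_nat krankD.
Qed.

Lemma asymptotic_rank_ge0 (R : realType) (F : fieldType) k
    (J : 'I_k -> finType) (T : tensor F J) :
  (0 < k)%N -> (forall i, J i) -> 0 <= asymptotic_rank R T.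
Proof.
move=> k0 x0; apply: limr_ge; last by near=> n; exact: powR_ge0.
apply: (@is_cvg_root _ (fun n => (krank T n)%:R)) => // m p.
by rewrite -natrM ler_nat krankD.
Unshelve. all: by end_near.
Qed.

Lemma asymptotic_rank_closure (R : realType) (F : fieldType) k
    (J : 'I_k -> finType) (A : set (tensor F J)) (T : tensor F J) (r : R) :
  (0 < k)%N -> (forall i, J i) -> 0 <= r ->
  (forall S, A S -> asymptotic_rank R S <= r) ->
  (forall p : mpoly.mpoly #|mindex J| F,
     (forall S, A S ->
        mpoly.meval (fun j : 'I_#|mindex J| => S (enum_val j)) p = 0) ->
     mpoly.meval (fun j : 'I_#|mindex J| => T (enum_val j)) p = 0) ->
  asymptotic_rank R T <= r.
Proof.
move=> k0 x0 r0 Ar TA; apply/asymptotic_rank_leP => // b rb.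
(* The gap from [r] to [b1] gives growth bounds for points of [A]; the gap from [b1] to [b] absorbs
   the number [N] of terms. *)
pose b1 := (r + b) / 2.
have b1_gt0 : 0 < b1 by rewrite /b1; lra.
have b1b : b1 < b by rewrite /b1; lra.
have rb1 : r < b1 by rewrite /b1; lra.
have b_gt0 : 0 < b := lt_trans b1_gt0 b1b.
have [n n0 nb] := expr_dominates_poly #|mindex J| b1_gt0 b1b.
have [N [Nn [c [S [AS TE]]]]] := power_in_span n TA.
have gS a : growth (fun m => (krank (S a) m)%:R) b1.
  have [Sg _] := asymptotic_rank_leP (S a) k0 x0 r0.
  by apply: Sg => //; exact: (Ar _ (AS a)).
have [C SC] := choice gS.
have mix := krank_mix k0 x0 (fun w => TE (fun j => at_pos w j)) SC.
apply: (@growth_sub _ _ b (\prod_a C a) n) => //.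
  by move=> m p; rewrite -natrM ler_nat krankD.
move=> m; apply: (le_trans (mix m)); rewrite mulnC exprM.
apply: ler_wpM2l.
  (* The growth bound at exponent 0 shows that [C a] is nonnegative. *)
  apply: prodr_ge0 => a _; have := SC a 0%N; rewrite mulr1; exact: le_trans.
apply: lerXn2r; rewrite ?nnegrE ?mulr_ge0 ?exprn_ge0 ?ler0n //;
  rewrite ?(ltW b1_gt0) ?(ltW b_gt0) //.
apply: le_trans nb; rewrite ler_wpM2r ?ler_nat //.
by rewrite exprn_ge0 // ltW.
Qed.

Theorem theorem1p2 (R : realType) (F : fieldType) (k : nat) (hk : (3 <= k)%N)
  (d : 'I_k -> nat) (hd : forall i : 'I_k, (1 <= d i)%N) (r : R) :
  zariski_closed
    [set T : tensor F (fun i : 'I_k => 'I_(d i) : finType)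
       | asymptotic_rank R T <= r].
Proof.
set A := [set T | _].
have k0 : (0 < k)%N by apply: leq_trans hk.
have x0 (i : 'I_k) : 'I_(d i) := Ordinal (hd i).
(* With all polynomials vanishing on [A], the zero locus is the Zariski closure of [A]. *)
exists [set p | forall S, A S ->
  mpoly.meval (fun j => S (enum_val j)) p = 0].
apply/seteqP; split=> T TA; first by move=> p; apply.
(* If [A] were empty, as for negative [r], the constant 1 would vanish on it and exclude [T]. A
   point of [A] also yields [0 <= r]. *)
have [S AS] : exists S, A S.
  apply: contrapT => nA; suff /eqP : (1 : F) = 0 by rewrite oner_eq0.
  rewrite -(TA 1) ?mpoly.meval1 // => S AS; by case: nA; exists S.
apply: (@asymptotic_rank_closure R F k _ A) => //.
exact: le_trans (asymptotic_rank_ge0 R S k0 x0) AS.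
Qed.
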